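(* Suppose $d\ge 5$, $K\subseteq\mathbb{C}$ is a real closed field, and there exist $\lambda_i,\alpha_i,\beta_i\in\mathbb{C}$ ($i=1,2,3$) such that $$f(x,y)=\lambda_1(\alpha_1x+\beta_1y)^d+\lambda_2(\alpha_2x+\beta_2y)^d+\lambda_3(\alpha_3x+\beta_3y)^d\in K[x,y]$$ is an honest representation, and $L_K(f)>3$. If $$u=(\beta_1\alpha_2-\beta_2\alpha_1)^2(\beta_1\alpha_3-\beta_3\alpha_1)^2(\beta_2\alpha_3-\beta_3\alpha_2)^2,$$ then $L_{K(\sqrt u)}(f)=3$. One of the summands $\lambda_i(\alpha_ix+\beta_iy)^d$ in this representation is in $K[x,y]$, whereas the other two summands are conjugates of each other in $K(\sqrt u)$.
   Context: For a field $F\subseteq\mathbb{C}$ and a binary form (homogeneous polynomial in $x,y$) $f\in F[x,y]$ of degree $d$, the $F$-rank $L_F(f)$ is the smallest $r$ for which there exist $\lambda_j,\alpha_j,\beta_j\in F$ with $f(x,y)=\sum_{j=1}^r\lambda_j(\alpha_jx+\beta_jy)^d$. A representation $f=\sum_{j=1}^r\lambda_j(\alpha_jx+\beta_jy)^d$ is honest if its summands are pairwise distinct, that is, if $\lambda_i\lambda_j(\alpha_i\beta_j-\alpha_j\beta_i)\ne 0$ whenever $i\ne j$.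
   Formalization: As stated u depends on how the pairs (α_j,β_j) are scaled, and the claim can fail; here u is computed after rescaling the pairs by nonzero scalars so that ∏(β_j x − α_j y) lies in K[x,y]; such a rescaling is proved to exist and the claim holds for every one. *)

(* Defs.v *)
From HB Require Import structures.
From mathcomp Require Import all_boot all_order all_algebra.
From mathcomp Require Import boolp reals.
From mathcomp Require Import mpoly complex.

Set Implicit Arguments.
Unset Strict Implicit.
Unset Printing Implicit Defensive.

Import Order.TTheory GRing.Theory Num.Theory.
Local Open Scope ring_scope.

(* Subfields F of C are predicates on C.  The variables x and y are 'X_0 and  *)
(* 'X_1 in {mpoly C[2]}.                                                      *)
Section BinaryForms.
Variable C : fieldType.
Implicit Types (F L : {pred C}) (f p q : {mpoly C[2]}).

Definition linform (a b : C) : {mpoly C[2]} := a *: 'X_0 + b *: 'X_1.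

Definition summand (d : nat) (l a b : C) : {mpoly C[2]} :=
  l *: linform a b ^+ d.

Definition has_repr F (d : nat) f (r : nat) : Prop :=
  exists lambda alpha beta : 'I_r -> C,
    (forall j, [/\ lambda j \in F, alpha j \in F & beta j \in F]) /\
    f = \sum_(j < r) summand d (lambda j) (alpha j) (beta j).

(* The value 0 when no representation exists is a convention only: over a     *)
(* field of characteristic 0, every form of degree d over F has one.          *)
Definition rank F (d : nat) f : nat :=
  if pselect (exists r, `[< has_repr F d f r >]) is left h then ex_minn h
  else 0%N.

Definition honest (r : nat) (lambda alpha beta : 'I_r -> C) : Prop :=
  forall i j, i != j ->
    lambda i * lambda j * (alpha i * beta j - alpha j * beta i) != 0.

Definition adjoin F (s : C) : {pred C} :=
  [pred z | `[< forall E : {pred C}, divring_closed E ->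
                  {subset F <= E} -> s \in E -> z \in E >]].

(* sigma is a field automorphism of L fixing F pointwise; its values outside  *)
(* L are irrelevant (injectivity on L is automatic).                          *)
Definition is_aut F L (sigma : C -> C) : Prop :=
  [/\ {in L, forall z, sigma z \in L},
      {in L, forall z, exists2 t, t \in L & sigma t = z},
      {in L &, {morph sigma : z t / z + t}},
      {in L &, {morph sigma : z t / z * t}}
    & {in F, forall z, sigma z = z}].

Definition conjugates F L p q : Prop :=
  [/\ p \is a mpolyOver 2 L, q \is a mpolyOver 2 L
    & exists2 sigma, is_aut F L sigma & forall m, q@_m = sigma p@_m].

(* A representation determines each pair (alpha j, beta j) only up to a       *)
(* nonzero scalar c j (compensated in lambda j), which multiplies disc3 by    *)
(* (\prod_j c j) ^+ 4 and so can change the field generated by its square     *)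
(* root.  The scalars are pinned down by asking that the form with zeros      *)
(* (alpha j : beta j), whose discriminant is disc3, be defined over F.        *)
Definition normalized F (alpha beta : 'I_3 -> C) : Prop :=
  \prod_(j < 3) (beta j *: 'X_0 - alpha j *: 'X_1) \is a mpolyOver 2 F.

Definition disc3 (alpha beta : 'I_3 -> C) : C :=
  (beta 0 * alpha 1 - beta 1 * alpha 0) ^+ 2 *
  (beta 0 * alpha 2%:R - beta 2%:R * alpha 0) ^+ 2 *
  (beta 1 * alpha 2%:R - beta 2%:R * alpha 1) ^+ 2.

End BinaryForms.

Definition image_field (K C : fieldType) (iota : {rmorphism K -> C}) :
    {pred C} :=
  [pred z | `[< exists x, z = iota x >]].

(* Main.v *)
(* Sylvester's method: the power sums sum_j lambda_j alpha_j^(d-k) beta_j^k are,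
   up to binomials, the coefficients of f.  Their Hankel matrix has entries in K
   and rank < 4, so a nonzero binary cubic over K vanishes at the three points
   (alpha_j : beta_j), which therefore lie in P^1(K(i)) as K(i) is algebraically
   closed.  Since at most d + 1 pairwise independent d-th powers are linearly
   independent, the representation is unique, so the conjugation of K(i) over K
   permutes the summands.  It does not fix all of them since the K-rank exceeds
   3, hence it is a transposition that changes the sign of the Vandermonde
   product of the points.  Up to a factor in K this product is a square root of
   u, so K(sqrt u) = K(i). *)
Require Import Defs.
From HB Require Import structures.
From mathcomp Require Import all_boot all_order all_algebra.
From mathcomp Require Import boolp reals.
From mathcomp Require Import mpoly complex zify ring.

Set Implicit Arguments.
Unset Strict Implicit.
Unset Printing Implicit Defensive.

Import Order.TTheory GRing.Theory Num.Theory.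
Local Open Scope ring_scope.

Lemma ord3_other (i : 'I_3) : exists j, i != j.
Proof. by case: i => -[|k] klt; [exists 1 | exists 0]. Qed.

(** * Power sums of points on the projective line *)

Section PowerSums.
Variable F : fieldType.

(** The coefficients [w] are fixed before [p] and [q], so one product of linear forms can be
    evaluated at many points. *)
Lemma prod_linear_forms_coef (s : seq (F * F)) :
  exists w : nat -> F, forall p q : F,
    \prod_(l <- s) (l.1 * p + l.2 * q) =
      \sum_(k < (size s).+1) w k * (p ^+ (size s - k) * q ^+ k).
Proof.
elim: s => [|l s [w IHs]].
  exists (fun=> 1) => p q.
  by rewrite big_nil big_ord_recl big_ord0 addr0 !mulr1.
(* The term in [p] keeps the index and the term in [q] shifts it by one. The guard discards [w] past
   the degree, where its values are arbitrary. *)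
exists (fun k => (if (k <= size s)%N then l.1 * w k else 0) +
                 (if k is k'.+1 then l.2 * w k' else 0)) => p q.
rewrite big_cons IHs /=.
under [RHS]eq_bigr do rewrite mulrDl.
rewrite big_split mulrDl; congr (_ + _).
  rewrite [RHS]big_ord_recr /= ltnn mul0r addr0 mulr_sumr.
  apply: eq_bigr => k _; have lek : (k <= size s)%N by rewrite -ltnS.
  by rewrite lek subSn // exprS; ring.
rewrite [RHS]big_ord_recl /= mul0r add0r mulr_sumr.
by apply: eq_bigr => k _; rewrite /bump /= add1n subSS exprS; ring.
Qed.

(** Multiply linear forms vanishing at the points of [s], pad to degree [n] with a form that is
    nonzero at [(p, q)], and divide by the value there. *)
Lemma separating_form (n : nat) (s : seq (F * F)) (p q : F) :
  (size s <= n)%N -> (p, q) != (0, 0) ->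
  {in s, forall x, x != (0, 0) -> x.1 * q != x.2 * p} ->
  exists w : nat -> F,
    \sum_(k < n.+1) w k * (p ^+ (n - k) * q ^+ k) = 1 /\
    {in s, forall x, \sum_(k < n.+1) w k * (x.1 ^+ (n - k) * x.2 ^+ k) = 0}.
Proof.
move=> len pq0 sP.
pose e : F * F := if p != 0 then (1, 0) else (0, 1).
have eP : e.1 * p + e.2 * q != 0.
  rewrite /e; case: ifP => [p0|/negbFE/eqP p0] /=.
    by rewrite mul1r mul0r addr0.
  by move: pq0; rewrite p0 xpair_eqE eqxx mul0r add0r mul1r.
(* Every linear form vanishes at [(0, 0)]; choosing [e] for it keeps the product nonzero at
   [(p, q)]. *)
pose form x : F * F := if x == (0, 0) then e else (- x.2, x.1).
pose l := [seq form x | x <- s] ++ nseq (n - size s) e.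
have [w] := prod_linear_forms_coef l.
have -> : size l = n by rewrite size_cat size_map size_nseq subnKC.
move=> wE.
have lP : \prod_(y <- l) (y.1 * p + y.2 * q) != 0.
  rewrite prodf_seq_neq0; apply/allP => y.
  rewrite mem_cat => /orP[/mapP[x xs ->]|]; last by move=> /nseqP[->].
  apply/implyP => _; rewrite /form; case: (eqVneq x (0, 0)) => // x0 /=.
  by rewrite addrC mulNr subr_eq0 sP.
exists (fun k => w k / \prod_(y <- l) (y.1 * p + y.2 * q)); split.
  rewrite -[RHS](divff lP) [X in _ = X / _]wE mulr_suml.
  by apply: eq_bigr => k _; rewrite mulrAC.
move=> x xs.
have : \prod_(y <- l) (y.1 * x.1 + y.2 * x.2) = 0.
  apply/eqP; rewrite prodf_seq_eq0; apply/hasP; exists (form x).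
    by rewrite mem_cat map_f.
  rewrite /form; case: (eqVneq x (0, 0)) => [->|x0] /=.
    by rewrite !mulr0 addr0.
  by rewrite mulNr mulrC addNr.
rewrite wE => /(congr1 (fun z => z / \prod_(y <- l) (y.1 * p + y.2 * q))).
rewrite mul0r mulr_suml => /(etrans _); apply.
by apply: eq_bigr => k _; rewrite mulrAC.
Qed.

(** The pairs are distinct points of the projective line; with at least two indices this also
    excludes the pair [(0, 0)]. *)
Definition independent (I : finType) (p q : I -> F) : Prop :=
  forall i j, i != j -> p i * q j != q i * p j.

(** A functional [w] on power sums acts by evaluating the form with coefficients [w] at the
    points. *)
Lemma pairing_sum (I : finType) (d : nat) (w : nat -> F) (m p q : I -> F) :
  \sum_(k < d.+1) w k * \sum_i m i * (p i ^+ (d - k) * q i ^+ k) =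
  \sum_i m i * \sum_(k < d.+1) w k * (p i ^+ (d - k) * q i ^+ k).
Proof.
under eq_bigr do rewrite mulr_sumr.
rewrite exchange_big; apply: eq_bigr => i _.
by rewrite mulr_sumr; apply: eq_bigr => k _; rewrite mulrCA.
Qed.

(** If point [i] matched no point of the second family, a form of degree [d] could vanish at the at
    most [d] other points of both families and equal 1 at point [i]. Pairing it with both sides
    would give [m i = 0]. *)
Lemma power_sums_matching (I J : finType) (d : nat) (m p q : I -> F)
    (n r t : J -> F) :
  (#|I| + #|J| <= d.+1)%N -> independent p q ->
  (forall k, (k <= d)%N -> \sum_i m i * (p i ^+ (d - k) * q i ^+ k) =
                           \sum_j n j * (r j ^+ (d - k) * t j ^+ k)) ->
  forall i, (p i, q i) != (0, 0) -> m i != 0 ->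
  exists j, (r j, t j) != (0, 0) /\ r j * q i = t j * p i.
Proof.
move=> IJd indep E i Pi0 mi0.
apply: contrapT => nex.
pose s := [seq (r j, t j) | j : J] ++ [seq (p j, q j) | j in predC1 i].
have szs : (size s <= d)%N.
  rewrite size_cat !size_map -enumT -!cardE cardC1 -ltnS (leq_trans _ IJd) //.
  by rewrite addnC -addSn prednK //; apply/card_gt0P; exists i.
have [|w [w1 w0]] := separating_form szs Pi0.
  move=> x; rewrite mem_cat => /orP[/mapP[j _ -> /= x0]|/mapP[j]].
    by apply/negP => /eqP ?; apply: nex; exists j.
  by rewrite mem_enum inE => ji -> _; rewrite /= indep.
case/eqP: mi0.
have : \sum_(k < d.+1) w k * \sum_i m i * (p i ^+ (d - k) * q i ^+ k) = 0.
  under eq_bigr do rewrite E -1?ltnS //.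
  rewrite pairing_sum big1 // => j _.
  by rewrite (w0 (r j, t j)) ?mulr0 // mem_cat map_f ?mem_enum.
rewrite pairing_sum (bigD1 i) //= w1 mulr1 big1 ?addr0 // => j ji.
by rewrite (w0 (p j, q j)) ?mulr0 // mem_cat map_f ?mem_enum ?orbT.
Qed.

Lemma independent_neq0 (I : finType) (p q : I -> F) (i j : I) :
  independent p q -> i != j -> (p i, q i) != (0, 0).
Proof.
move=> indep /indep; apply: contraNneq => -[-> ->]; by rewrite !mul0r.
Qed.

(** This is matching against an empty second family: a nonzero weight would need a partner there. *)
Lemma power_sums_free (d : nat) (m p q : 'I_3 -> F) :
  (2 <= d)%N -> independent p q ->
  (forall k, (k <= d)%N -> \sum_i m i * (p i ^+ (d - k) * q i ^+ k) = 0) ->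
  forall i, m i = 0.
Proof.
move=> d2 indep E i; apply: contrapT => /eqP mi0.
have [j ij] := ord3_other i.
have [] := @power_sums_matching 'I_3 'I_0 d m p q (fun=> 0) (fun=> 0) (fun=> 0)
  _ indep _ i (independent_neq0 indep ij) mi0.
- by rewrite !card_ord.
- by move=> k kd; rewrite E // big_ord0.
- by case.
Qed.

(** The dual basis to the three points: it recovers a single weight as a linear combination of power
    sums. *)
Lemma interpolation (d : nat) (p q : 'I_3 -> F) :
  (2 <= d)%N -> independent p q -> forall i : 'I_3, exists w : nat -> F,
    forall j, \sum_(k < d.+1) w k * (p j ^+ (d - k) * q j ^+ k) = (j == i)%:R.
Proof.
move=> d2 indep i.
have [j0 ij0] := ord3_other i.
pose s := [seq (p j, q j) | j in predC1 i].
have szs : (size s <= d)%N by rewrite size_map -cardE cardC1 card_ord.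
have [|w [w1 w0]] := separating_form szs (independent_neq0 indep ij0).
  by move=> x /mapP[j]; rewrite mem_enum inE => ji -> _; rewrite /= indep.
exists w => j; case: eqVneq => [->|ji]; first exact: w1.
by rewrite (w0 (p j, q j)) // map_f // mem_enum.
Qed.

End PowerSums.

(** * Coefficients of sums of [d]-th powers *)

Section BinaryForms.
Variable C : numClosedFieldType.
Implicit Types (f : {mpoly C[2]}) (m : 'X_{1..2}).

Lemma mdeg2 m : mdeg m = (m 0%R + m 1%R)%N.
Proof.
rewrite mdegE !big_ord_recl big_ord0 addn0.
by congr (m _ + m _)%N; apply: val_inj.
Qed.

Lemma mcoeff_summand (d : nat) (l a b : C) m :
  (summand d l a b)@_m =
    (l * (a ^+ (d - m 1) * b ^+ m 1)) *+ ((mdeg m == d) * 'C(d, m 1)).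
Proof.
rewrite /summand /linform mcoeffZ exprDn raddf_sum /=.
have term (i : 'I_d.+1) :
    ((a *: 'X_0) ^+ (d - i) * (b *: 'X_1) ^+ i *+ 'C(d, i) : {mpoly C[2]})@_m =
    (a ^+ (d - i) * b ^+ i) *+ (((m 0%R == d - i)%N && (m 1%R == i :> nat)) * 'C(d, i)).
  rewrite mcoeffMn !exprZn -scalerAl -scalerAr scalerA mcoeffZ !mpolyXn -mpolyXD.
  rewrite mcoeffX mulr_natr mulrnA; congr (_ *+ _ *+ _).
  congr (nat_of_bool _); apply/eqP/andP => [<-|[/eqP m0 /eqP m1]].
    by rewrite !mnmDE !mulmnE !mnm1E /= !mul1n !mul0n addn0 add0n.
  apply/mnmP => j; rewrite mnmDE !mulmnE !mnm1E.
  have [->|->] : j = 0 \/ j = 1.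
    by case: j => -[|[|j]] jlt //; [left | right]; apply: val_inj.
  - by rewrite m0 /= mul1n mul0n addn0.
  - by rewrite m1 /= mul1n mul0n add0n.
rewrite (eq_bigr _ (fun i _ => term i)) mdeg2.
case: (eqVneq (m 0%R + m 1%R)%N d) => [<-|md]; last first.
  rewrite mul0n mulr0n big1 ?mulr0 // => i _.
  case: (eqVneq (m 1%R) i) => [mi|]; last by rewrite andbF.
  rewrite andbT; case: eqP => // m0; case/eqP: md.
  by rewrite m0 mi subnK // -ltnS.
have m1 : (m 1%R < (m 0%R + m 1%R).+1)%N by rewrite ltnS leq_addl.
rewrite (bigD1 (Ordinal m1)) //= big1 ?addr0.
  by rewrite addnK !eqxx !mul1n mulrnAr.
move=> i; rewrite -val_eqE /= eq_sym => /negbTE ->; by rewrite andbF.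
Qed.

Lemma mcoeff_sum_summand (I : finType) (d : nat) (l a b : I -> C) m :
  (\sum_i summand d (l i) (a i) (b i))@_m =
    (\sum_i l i * (a i ^+ (d - m 1) * b i ^+ m 1)) *+ ((mdeg m == d) * 'C(d, m 1)).
Proof.
rewrite raddf_sum -sumrMnl; apply: eq_bigr => i _; exact: mcoeff_summand.
Qed.

Lemma mcoeff_power_sum (I : finType) (d k : nat) (l a b : I -> C) :
  (k <= d)%N -> exists m,
  (\sum_i summand d (l i) (a i) (b i))@_m =
    (\sum_i l i * (a i ^+ (d - k) * b i ^+ k)) *+ 'C(d, k).
Proof.
move=> kd; exists [multinom (if i == 0%R then d - k else k)%N | i < 2].
by rewrite mcoeff_sum_summand mdeg2 !mnmE /= subnK // eqxx mul1n.
Qed.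

Lemma sum_summand_ext (I J : finType) (d : nat) (l a b : I -> C) (l' a' b' : J -> C) :
  (forall k, (k <= d)%N -> \sum_i l i * (a i ^+ (d - k) * b i ^+ k) =
                           \sum_j l' j * (a' j ^+ (d - k) * b' j ^+ k)) ->
  \sum_i summand d (l i) (a i) (b i) = \sum_j summand d (l' j) (a' j) (b' j).
Proof.
move=> E; apply/mpolyP => m; rewrite !mcoeff_sum_summand.
case: (eqVneq (mdeg m) d) => [md|]; last by rewrite mul0n !mulr0n.
by rewrite E // -md mdeg2 leq_addl.
Qed.

Lemma sum_summand_power_sums (I J : finType) (d : nat)
    (l a b : I -> C) (l' a' b' : J -> C) :
  \sum_i summand d (l i) (a i) (b i) = \sum_j summand d (l' j) (a' j) (b' j) ->
  forall k, (k <= d)%N -> \sum_i l i * (a i ^+ (d - k) * b i ^+ k) =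
                          \sum_j l' j * (a' j ^+ (d - k) * b' j ^+ k).
Proof.
move=> E k kd; pose m : 'X_{1..2} := [multinom (if i == 0%R then d - k else k)%N | i < 2].
have := congr1 (mcoeff m) E; rewrite !mcoeff_sum_summand mdeg2 !mnmE /= subnK // eqxx.
(* The binomial factor cancels because the characteristic is 0. *)
rewrite mul1n -[LHS]mulr_natr -[RHS]mulr_natr; apply: mulIf.
by rewrite pnatr_eq0 -lt0n bin_gt0.
Qed.

Lemma mpolyOver_coefP (S : {pred C}) f :
  0 \in S -> reflect (forall m, f@_m \in S) (f \is a mpolyOver 2 S).
Proof.
move=> S0; apply: (iffP allP) => [fS m|fS _ /mapP[m _ ->]]; last exact: fS.
have [m_f|] := boolP (m \in msupp f); first exact/fS/map_f.
by rewrite -mcoeff_eq0 => /eqP ->.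
Qed.

End BinaryForms.

(** * The image of K as a subfield of C *)

Section ImageField.
Variables (K : fieldType) (C : numClosedFieldType) (phi : {rmorphism K -> C}).

Lemma image_fieldP z : reflect (exists x, z = phi x) (z \in image_field phi).
Proof. exact: asboolP. Qed.

Lemma mem_image_field x : phi x \in image_field phi.
Proof. by apply/image_fieldP; exists x. Qed.

Lemma image_field_closed : divring_closed (image_field phi).
Proof.
split; first by rewrite -(rmorph1 phi) mem_image_field.
- move=> _ _ /image_fieldP[x ->] /image_fieldP[y ->].
  by rewrite -rmorphB mem_image_field.
- move=> _ _ /image_fieldP[x ->] /image_fieldP[y ->].
  by rewrite -fmorph_div mem_image_field.
Qed.

Lemma power_sum_image_field (I : finType) (d : nat) (l a b : I -> C) :
  \sum_i summand d (l i) (a i) (b i) \is a mpolyOver 2 (image_field phi) ->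
  forall k, (k <= d)%N ->
  exists x, phi x = \sum_i l i * (a i ^+ (d - k) * b i ^+ k).
Proof.
move=> fK k kd.
have [m fm] := mcoeff_power_sum l a b kd.
have S0 : 0 \in image_field phi by rewrite -(rmorph0 phi) mem_image_field.
have /image_fieldP[x] := mpolyOver_coefP _ S0 fK m.
rewrite fm -mulr_natr => E; exists (x / 'C(d, k)%:R).
rewrite fmorph_div -E rmorph_nat mulfK //.
by rewrite pnatr_eq0 -lt0n bin_gt0.
Qed.

End ImageField.

(** * The apolar cubic over K *)

Section Hankel.
Variables (K : fieldType) (C : numClosedFieldType) (iota : {rmorphism K -> C}).

(* The 4 x (d - 2) Hankel matrix of the power sums has entries in K and factors
   through the three points, so it has a K-rational left kernel vector: the
   coefficients of a binary cubic apolar to the form. *)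
Lemma rational_cubic (d : nat) (l a b : 'I_3 -> C) :
  (5 <= d)%N -> independent a b -> (forall i, l i != 0) ->
  (forall k, (k <= d)%N ->
     exists x, iota x = \sum_i l i * (a i ^+ (d - k) * b i ^+ k)) ->
  exists2 v : 'rV[K]_4, v != 0 &
    forall i, \sum_(t < 4) iota (v 0 t) * (a i ^+ (3 - t) * b i ^+ t) = 0.
Proof.
move=> d5 indep l0 rat.
have /choice[s sE] : forall k, exists x, (k <= d)%N ->
    iota x = \sum_i l i * (a i ^+ (d - k) * b i ^+ k).
  by move=> k; case: (leqP k d) => [/rat[x xE]|]; [exists x | exists 0].
(* Since [t <= 3] and [k <= d - 3], every entry is a power sum of index at most [d], never the
   default value 0 of [s]. *)
pose H : 'M[K]_(4, d - 2) := \matrix_(t, k) s (t + k)%N.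
have HE : map_mx iota H =
    (\matrix_(t < 4, i < 3) (l i * (a i ^+ (3 - t) * b i ^+ t))) *m
    (\matrix_(i < 3, k < d - 2) (a i ^+ (d - 3 - k) * b i ^+ k)).
  apply/matrixP => t k; rewrite !mxE.
  have tk : (t + k <= d)%N by have := ltn_ord t; have := ltn_ord k; lia.
  rewrite sE //; apply: eq_bigr => i _; rewrite !mxE.
  have -> : (d - (t + k) = (3 - t) + (d - 3 - k))%N.
    by have := ltn_ord t; have := ltn_ord k; lia.
  by rewrite !exprD; ring.
(* The factorization over C passes through dimension 3, and rank is invariant under field
   extension. *)
have rkH : (\rank H < 4)%N by rewrite -(mxrank_map iota) HE ltnS mulmx_max_rank.
have kerH : kermx H != 0 by rewrite kermx_eq0 /row_free neq_ltn rkH.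
have vH : nz_row (kermx H) *m H = 0 by apply/sub_kermxP; exact: nz_row_sub.
exists (nz_row (kermx H)); first by rewrite nz_row_eq0.
move: (nz_row _) vH => v vH i.
(* The kernel equations are vanishing power sums of degree [d - 3 >= 2], whose weights are [l i]
   times the value of the cubic at point [i]. *)
have v0 := power_sums_free (d := d - 3)
  (m := fun i => l i * \sum_(t < 4) iota (v 0 t) * (a i ^+ (3 - t) * b i ^+ t))
  _ indep _ i.
apply/eqP; rewrite -(mulrI_eq0 _ (mulfI (l0 i))); apply/eqP/v0; first by lia.
move=> k kd3; have kd : (k < d - 2)%N by lia.
have /matrixP/(_ 0 (Ordinal kd)) := congr1 (map_mx iota) vH.
rewrite map_mxM HE mulmxA !mxE rmorph0 => /(etrans _); apply.
apply: eq_bigr => j _; rewrite !mxE; congr (_ * _).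
by rewrite mulr_sumr; apply: eq_bigr => t _; rewrite !mxE; ring.
Qed.

End Hankel.

(** * The embedding of K(i) into C and the points over K(i) *)

Section Complexification.
Variables (K : rcfType) (C : numClosedFieldType) (iota : {rmorphism K -> C}).

Definition complexify (z : K[i]) : C :=
  iota (complex.Re z) + 'i * iota (complex.Im z).

Fact complexify_is_zmod_morphism : zmod_morphism complexify.
Proof. by case=> [a b] [c e]; rewrite /complexify /= !rmorphB; ring. Qed.

Fact complexify_is_monoid_morphism : monoid_morphism complexify.
Proof.
split; first by rewrite /complexify /= rmorph1 rmorph0 mulr0 addr0.
case=> [a b] [c e]; rewrite /complexify /= rmorphB rmorphD !rmorphM.
have := sqrCi C; rewrite expr2; move: ('i : C) => j jj.
transitivity (iota a * iota c + j * j * (iota b * iota e)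
   + j * (iota a * iota e + iota b * iota c)); last by ring.
by rewrite jj; ring.
Qed.

HB.instance Definition _ := GRing.isZmodMorphism.Build K[i] C complexify
  complexify_is_zmod_morphism.
HB.instance Definition _ := GRing.isMonoidMorphism.Build K[i] C complexify
  complexify_is_monoid_morphism.

Lemma complexify_real (x : K) : complexify x%:C%C = iota x.
Proof. by rewrite /complexify /= rmorph0 mulr0 addr0. Qed.

Lemma conjc_eq_real (z : K[i]) : conjc z = z -> exists x : K, z = x%:C%C.
Proof.
case: z => x y [] /eqP; rewrite -subr_eq0 -opprD oppr_eq0 -mulr2n mulrn_eq0 /=.
by move=> /eqP ->; exists x.
Qed.

(** K(i) is algebraically closed, so [r] splits there and its roots in C are images of its roots in
    K(i). *)
Lemma root_complexify (r : {poly K[i]}) (z : C) :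
  r != 0 -> root (map_poly complexify r) z -> exists t, z = complexify t.
Proof.
move=> r0; have [s ->] := closed_field_poly_normal r.
rewrite map_polyZ rootZ /=; last by rewrite fmorph_eq0 lead_coef_eq0.
rewrite rmorph_prod.
under eq_bigr do rewrite rmorphB /= map_polyX map_polyC /=.
rewrite -(big_map complexify predT (fun z => 'X - z%:P)) root_prod_XsubC.
by move=> /mapP[t _ ->]; exists t.
Qed.

(** A unique representative for each projective point, of a shape that conjugation preserves. *)
Definition normal_point (x : K[i] * K[i]) : Prop := x.1 = 1 \/ x = (0, 1).

Lemma normal_point_inj x y :
  normal_point x -> normal_point y -> x.1 * y.2 = x.2 * y.1 -> x = y.
Proof.
case: x y => [p q] [r t] [/= ->|[-> ->]] [/= ->|[-> ->]] //=.
- by rewrite mul1r mulr1 => ->.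
- by rewrite mulr0 mul1r => /eqP; rewrite oner_eq0.
- by rewrite mul0r mul1r => /esym/eqP; rewrite oner_eq0.
Qed.

Lemma points_complexify (d : nat) (l a b : 'I_3 -> C) :
  (5 <= d)%N -> independent a b -> (forall i, l i != 0) ->
  (forall k, (k <= d)%N ->
     exists x, iota x = \sum_i l i * (a i ^+ (d - k) * b i ^+ k)) ->
  forall i, exists x c, [/\ c != 0, normal_point x,
    c * a i = complexify x.1 & c * b i = complexify x.2].
Proof.
move=> d5 indep l0 rat i.
have [v v0 vP] := rational_cubic d5 indep l0 rat.
have Pi : (a i, b i) != (0, 0).
  have [j ij] := ord3_other i.
  exact: independent_neq0 indep ij.
case: (eqVneq (a i) 0) Pi => [a0|a0 _].
  rewrite a0 xpair_eqE eqxx /= => b0.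
  exists (0, 1), (b i)^-1; split; [by rewrite invr_eq0|by right| |] => /=.
    by rewrite mulr0 rmorph0.
  by rewrite mulVf // rmorph1.
(* The apolar cubic restricted to the affine chart [(1 : X)]; the point [(0 : 1)] outside this chart
   has been treated above. *)
pose r : {poly K[i]} := \sum_(t < 4) (v 0 t)%:C%C *: 'X^t.
have rE (t : 'I_4) : r`_t = (v 0 t)%:C%C.
  rewrite /r coef_sum (bigD1 t) //= big1 => [|u ut].
    by rewrite coefZ coefXn eqxx mulr1 addr0.
  by rewrite coefZ coefXn eq_sym -(inj_eq val_inj) in ut *;
    rewrite (negbTE ut) mulr0.
have r0 : r != 0.
  apply: contraNneq v0 => r0; apply/eqP/rowP => t; rewrite mxE.
  by apply: (@complexI K); rewrite -rE r0 coef0.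
have [|t tE] := @root_complexify r (b i / a i) r0.
  rewrite /root /r rmorph_sum horner_sum.
  under eq_bigr do rewrite /= map_polyZ map_polyXn hornerZ hornerXn.
  rewrite -(mulrI_eq0 _ (mulfI (expf_neq0 3 a0))); apply/eqP.
  apply: etrans (vP i); rewrite mulr_sumr; apply: eq_bigr => t _.
  rewrite /= complexify_real mulrCA; congr (_ * _).
  rewrite expr_div_n; have t3 : (t <= 3)%N by rewrite -ltnS.
  by rewrite -{1}(subnK t3) exprD mulrACA divff ?expf_neq0 // mulr1.
exists (1, t), (a i)^-1; split; [by rewrite invr_eq0|by left| |] => /=.
  by rewrite mulVf // rmorph1.
by rewrite mulrC -tE.
Qed.

End Complexification.

(** * Conjugation permutes the summands *)

Section Conjugation.
Variable K : rcfType.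
Local Notation conj := (@conjc K : K[i] -> K[i]).

Lemma independent_conjc (I : finType) (p q : I -> K[i]) :
  independent p q -> independent (fun i => conj (p i)) (fun i => conj (q i)).
Proof.
move=> indep i j /indep; apply: contraNneq.
by rewrite -!rmorphM => /(inv_inj (@conjcK K)) ->.
Qed.

(* Both the form and its conjugate are the same sum of powers, and by
   power_sums_matching a sum of three d-th powers is unique when d >= 5. *)
Lemma conjc_permutes (d : nat) (l p q : 'I_3 -> K[i]) :
  (5 <= d)%N -> independent p q -> (forall i, l i != 0) ->
  (forall i, normal_point (p i, q i)) ->
  (forall k, (k <= d)%N -> conj (\sum_i l i * (p i ^+ (d - k) * q i ^+ k)) =
                           \sum_i l i * (p i ^+ (d - k) * q i ^+ k)) ->
  exists s : 'I_3 -> 'I_3, [/\ involutive s,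
    forall i, conj (p i) = p (s i), forall i, conj (q i) = q (s i)
    & forall i, conj (l i) = l (s i)].
Proof.
move=> d5 indep l0 norm real.
have conjE k : (k <= d)%N ->
    \sum_i conj (l i) * (conj (p i) ^+ (d - k) * conj (q i) ^+ k) =
    \sum_i l i * (p i ^+ (d - k) * q i ^+ k).
  move=> kd; rewrite -[RHS]real // [RHS]rmorph_sum; apply: eq_bigr => i _.
  by rewrite /= !rmorphM !rmorphXn.
have /choice[s sP] : forall i, exists j, (conj (p i), conj (q i)) = (p j, q j).
  move=> i; have indepC := independent_conjc indep.
  have [j ij] := ord3_other i.
  (* Two families of three points need [6 <= d + 1], which is the bound [d >= 5]. *)
  have [] := power_sums_matching (J := 'I_3) (d := d) _ indepC conjE
    (independent_neq0 indepC ij).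
  - by rewrite !card_ord.
  - by rewrite conjc_eq0.
  move=> t [_ E]; exists t; apply: normal_point_inj => //.
    by case: (norm i) => [/= ->|[-> ->]]; [left|right]; rewrite ?rmorph1 ?rmorph0.
  by rewrite /= mulrC -E mulrC.
have sp i : conj (p i) = p (s i) by case: (sP i).
have sq i : conj (q i) = q (s i) by case: (sP i).
have ss : involutive s.
  move=> i; apply/eqP; apply: contraT => /indep.
  by rewrite -!sp -!sq !conjcK mulrC eqxx.
(* After reindexing by [s], both sides of [conjE] have the same points, so the differences of the
   weights have vanishing power sums. *)
have ls : forall j, conj (l (s j)) - l j = 0.
  apply: (power_sums_free (d := d) _ indep); first by rewrite (leq_trans _ d5).
  move=> k kd; under eq_bigr do rewrite mulrBl.
  rewrite sumrB -conjE // [X in _ - X](reindex_inj (inv_inj ss)) /=.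
  by rewrite -sumrB big1 // => j _; rewrite !sp !sq !ss subrr.
exists s; split => // i.
by have /eqP := ls (s i); rewrite ss subr_eq0 => /eqP.
Qed.

End Conjugation.

(** An involution preserves the pair [j], [s j], hence fixes the one remaining index. *)
Lemma involution_ord3 (s : 'I_3 -> 'I_3) (j : 'I_3) :
  involutive s -> s j != j ->
  exists i, uniq [:: i; j; s j] /\ s i = i.
Proof.
move=> ss sj.
have [i ij] : exists i, i \notin [:: j; s j].
  apply/existsP; rewrite -negb_forall; apply/negP => /forallP all2.
  have := card_ord 3; rewrite -(cardC (mem [:: j; s j])).
  rewrite (eq_card0 (A := [predC _])) => [|t].
    rewrite addn0 => /eqP; rewrite eqn_leq => /andP[_].
    by rewrite leqNgt ltnS card_size.
  by apply: negbTE; rewrite negbK; apply: all2.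
have u : uniq [:: i; j; s j] by rewrite /= ij inE eq_sym sj.
have all3 t : t \in [:: i; j; s j].
  have sub : {subset [:: i; j; s j] <= enum 'I_3} by move=> x _; rewrite mem_enum.
  have [|_ ->] := uniq_min_size u sub; last by rewrite mem_enum.
  by rewrite -cardE card_ord.
exists i; split=> //.
move: ij (all3 (s i)); rewrite !inE negb_or => /andP[ij isj] /or3P[/eqP//| |] /eqP E.
  by case/eqP: isj; rewrite -E ss.
by case/eqP: ij; apply: (inv_inj ss).
Qed.

(** * The square root of the discriminant *)

Section Vandermonde.
Variable F : comNzRingType.
Implicit Types p q : 'I_3 -> F.

Definition vandermonde3 p q : F :=
  (q 0 * p 1 - q 1 * p 0) * (q 0 * p 2%:R - q 2%:R * p 0) *
  (q 1 * p 2%:R - q 2%:R * p 1).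

(** A transposition changes the sign of the factor of the two swapped points and preserves the
    product of the other two factors. *)
Lemma vandermonde3_swap p q (s : 'I_3 -> 'I_3) (i j : 'I_3) :
  uniq [:: i; j; s j] -> s i = i -> s (s j) = j ->
  vandermonde3 (p \o s) (q \o s) = - vandermonde3 p q.
Proof.
have e0 t : Ordinal (n:=3) (m:=0) t = 0 by apply: val_inj.
have e1 t : Ordinal (n:=3) (m:=1) t = 1 by apply: val_inj.
have e2 t : Ordinal (n:=3) (m:=2) t = 2%:R by apply: val_inj.
rewrite /vandermonde3 /=; case sjE: (s j) => [[|[|[|k]]] klt] //;
  case: j sjE => [[|[|[|k']]] kl'] //; case: i => [[|[|[|k'']]] kl''] //;
  rewrite ?e0 ?e1 ?e2 => -> // _ -> ->; ring.
Qed.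

(** Each index occurs in two of the three factors, whence the square. *)
Lemma vandermonde3Z p q (c : 'I_3 -> F) :
  vandermonde3 (fun i => c i * p i) (fun i => c i * q i) =
  (\prod_i c i) ^+ 2 * vandermonde3 p q.
Proof.
rewrite !big_ord_recl big_ord0 /vandermonde3.
have -> : lift ord0 ord0 = 1 :> 'I_3 by apply: val_inj.
have -> : lift ord0 (lift ord0 ord0) = 2%:R :> 'I_3 by apply: val_inj.
have -> : ord0 = 0 :> 'I_3 by apply: val_inj.
by ring.
Qed.

End Vandermonde.

Lemma disc3_vandermonde (C : fieldType) (a b : 'I_3 -> C) :
  disc3 a b = vandermonde3 a b ^+ 2.
Proof. by rewrite /disc3 /vandermonde3; ring. Qed.

(** * Lower bound for the rank *)

Section Rank.
Variable C : numClosedFieldType.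

Lemma honest_independent (r : nat) (l a b : 'I_r -> C) :
  honest l a b -> independent a b.
Proof.
move=> hon i j /hon; apply: contraNneq => E.
by rewrite [a j * _]mulrC E subrr mulr0.
Qed.

Lemma honest_neq0 (l a b : 'I_3 -> C) : honest l a b -> forall i, l i != 0.
Proof.
move=> hon i; have [j ij] := ord3_other i.
by have := hon i j ij; apply: contraNneq => ->; rewrite !mul0r.
Qed.

Lemma rank_leq (F : {pred C}) (d r : nat) f : has_repr F d f r -> (rank F d f <= r)%N.
Proof.
move=> rep; rewrite /rank; case: pselect => // h.
by case: ex_minnP => n _; apply; apply/asboolP.
Qed.

Lemma rank_eq (F : {pred C}) (d r : nat) f :
  has_repr F d f r -> (forall n, has_repr F d f n -> (r <= n)%N) -> rank F d f = r.
Proof.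
move=> rep least; apply/eqP; rewrite eqn_leq rank_leq //= /rank.
case: pselect => [h|[]]; last by exists r; apply/asboolP.
by case: ex_minnP => n /asboolP /least.
Qed.

(** If [n <= 2] then [3 + n <= d + 1], so each of the three points matches one of the [n] new ones.
    Distinct points have distinct partners, which is impossible. The field [F] is arbitrary. *)
Lemma honest_minimal (F : {pred C}) (d n : nat) (l a b : 'I_3 -> C) :
  (4 <= d)%N -> honest l a b ->
  has_repr F d (\sum_i summand d (l i) (a i) (b i)) n -> (3 <= n)%N.
Proof.
move=> d4 hon [l' [a' [b' [_ E]]]]; rewrite leqNgt; apply/negP => n3.
have indep := honest_independent hon.
have /choice[g gP] : forall i, exists j, (a' j, b' j) != (0, 0) /\ a' j * b i = b' j * a i.
  move=> i; have [j ij] := ord3_other i.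
  apply: (power_sums_matching (d := d) _ indep (sum_summand_power_sums E)).
  - by rewrite !card_ord; lia.
  - exact: independent_neq0 indep ij.
  - exact: honest_neq0 hon i.
have /leq_card : injective g; last by rewrite !card_ord leqNgt n3.
move=> i j gij; apply/eqP; apply: contraT => /indep /negP[].
have [ab0 Ei] := gP i; have [_] := gP j; rewrite -gij => Ej.
move: ab0; rewrite xpair_eqE negb_and => /orP[a0|b0]; apply/eqP.
  by apply: (mulfI a0); rewrite mulrCA Ej [RHS]mulrA Ei; ring.
by apply: (mulfI b0); rewrite mulrA -Ei [RHS]mulrCA -Ej; ring.
Qed.

End Rank.

(** * Descent of the representation to K(i) *)

Section Descent.
Variables (K : rcfType) (C : numClosedFieldType) (iota : {rmorphism K -> C}).
Local Notation phi := (complexify iota).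
Local Notation conj := (@conjc K : K[i] -> K[i]).

Lemma image_complexify_real (w : K[i]) :
  (phi w \in image_field iota) <-> (conj w = w).
Proof.
split=> [/image_fieldP[x]|/conjc_eq_real[x ->]]; last first.
  by rewrite complexify_real mem_image_field.
by rewrite -complexify_real => /fmorph_inj ->; rewrite conjc_real.
Qed.

Lemma sub_image_complexify : {subset image_field iota <= image_field phi}.
Proof.
by move=> _ /image_fieldP[x ->]; rewrite -complexify_real; exact: mem_image_field.
Qed.

(** Such a [w] is i times a nonzero element of K, so a field containing K and the image of [w]
    contains ['i]. *)
Lemma adjoin_complexify (w : K[i]) :
  conj w = - w -> w != 0 ->
  adjoin (image_field iota) (phi w) = image_field phi :> {pred C}.
Proof.
move=> cw w0; apply/funext => z; apply/asboolP/image_fieldP => [|[x ->]].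
  move=> /(_ _ (image_field_closed phi) sub_image_complexify (mem_image_field _ _)).
  by move/image_fieldP.
move=> E [E1 EB EV] KE wE.
have E0 : 0 \in E by rewrite -(subrr 1) EB.
have EN t : t \in E -> - t \in E by move=> tE; rewrite -sub0r EB.
have ED t t' : t \in E -> t' \in E -> t + t' \in E.
  by move=> tE tE'; rewrite -[t']opprK EB // EN.
have EM t t' : t \in E -> t' \in E -> t * t' \in E.
  by move=> tE tE'; rewrite -[t']invrK EV // -[t'^-1]mul1r EV.
case: w cw w0 wE => y v [/eqP]; rewrite -subr_eq0 opprK -mulr2n mulrn_eq0 /=.
move=> /eqP->; rewrite eq_complex /= eqxx /= => v0; rewrite /complexify /= rmorph0 add0r.
move=> ivE; apply: ED; first by rewrite KE // mem_image_field.
have iE : ('i : C) \in E.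
  rewrite -[X in X \in E](mulfK (_ : iota v != 0)) ?fmorph_eq0 //.
  by rewrite EV // KE // mem_image_field.
by apply: EM => //; rewrite KE // mem_image_field.
Qed.

Lemma conj_automorphism : exists2 sigma : C -> C,
  is_aut (image_field iota) (image_field phi) sigma &
  forall w, sigma (phi w) = phi (conj w).
Proof.
(* [r] inverts [phi] on its image, so that conjugation can be transported to C. *)
have /choice[r rP] : forall z, exists w, z \in image_field phi -> phi w = z.
  move=> z; case: (boolP (z \in image_field phi)) => [/image_fieldP[w ->]|_].
    by exists w.
  by exists 0.
have sE w : phi (conj (r (phi w))) = phi (conj w).
  by congr (phi (conj _)); apply: (fmorph_inj phi); rewrite /= rP // mem_image_field.
exists (fun z => phi (conj (r z))) => //; split.
- by move=> z _; exact: mem_image_field.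
- move=> _ /image_fieldP[w ->]; exists (phi (conj w)); first exact: mem_image_field.
  by rewrite sE conjcK.
- move=> _ _ /image_fieldP[v ->] /image_fieldP[w ->].
  by rewrite -rmorphD !sE -rmorphD -[in RHS]rmorphD.
- move=> _ _ /image_fieldP[v ->] /image_fieldP[w ->].
  by rewrite -rmorphM !sE -rmorphM -[in RHS]rmorphM.
- by move=> _ /image_fieldP[x ->]; rewrite -complexify_real sE conjc_real.
Qed.

(** The scalars [e] move the points to their normal representatives [p], [q] over K(i); [l] are the
    compensated weights and [s] is the action of conjugation. *)
Lemma descent (d : nat) (lambda alpha beta : 'I_3 -> C) :
  (5 <= d)%N -> honest lambda alpha beta ->
  let f := \sum_i summand d (lambda i) (alpha i) (beta i) in
  f \is a mpolyOver 2 (image_field iota) -> ~ has_repr (image_field iota) d f 3 ->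
  exists (e : 'I_3 -> C) (l p q : 'I_3 -> K[i]) (s : 'I_3 -> 'I_3) (i j : 'I_3),
    [/\ [/\ forall t, e t != 0, independent p q,
          forall t, e t * alpha t = phi (p t), forall t, e t * beta t = phi (q t)
        & forall t, lambda t = phi (l t) * e t ^+ d],
      [/\ involutive s, forall t, conj (p t) = p (s t),
          forall t, conj (q t) = q (s t) & forall t, conj (l t) = l (s t)]
    & uniq [:: i; j; s j] /\ s i = i].
Proof.
move=> d5 hon f fK norep.
have indep := honest_independent hon; have l0 := honest_neq0 hon.
have rat := power_sum_image_field fK.
have /choice[x /choice[e xeP]] := points_complexify d5 indep l0 rat.
pose p t := (x t).1; pose q t := (x t).2.
have e0 t : e t != 0 by case: (xeP t).
have norm t : normal_point (p t, q t) by rewrite -surjective_pairing; case: (xeP t).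
have pE t : e t * alpha t = phi (p t) by case: (xeP t).
have qE t : e t * beta t = phi (q t) by case: (xeP t).
have indepK : independent p q.
  move=> t u /indep; apply: contraNneq => /(congr1 phi); rewrite !rmorphM /= -!pE -!qE.
  by rewrite mulrACA [RHS]mulrACA => /mulfI ->; rewrite ?mulf_neq0.
pose mu t := lambda t / e t ^+ d.
have muE k : (k <= d)%N ->
    \sum_t mu t * (phi (p t) ^+ (d - k) * phi (q t) ^+ k) =
    \sum_t lambda t * (alpha t ^+ (d - k) * beta t ^+ k).
  move=> kd; apply: eq_bigr => t _; rewrite /mu -pE -qE !exprMn.
  rewrite [X in _ * X = _]mulrACA -exprD.
  by rewrite subnK // [LHS]mulrA divfK ?expf_neq0.
(* Interpolation over K(i) writes each weight as a K(i)-combination of power sums, which lie in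
   K. *)
have /choice[l lE] : forall t, exists z, phi z = mu t.
  move=> t; have [|w wP] := interpolation (d := d) _ indepK t.
    by rewrite (leq_trans _ d5).
  have phi_w u : \sum_(k < d.+1) phi (w k) * (phi (p u) ^+ (d - k) * phi (q u) ^+ k) =
      (u == t)%:R.
    rewrite -(rmorph_nat phi) -wP rmorph_sum.
    by apply: eq_bigr => k _; rewrite /= !rmorphM !rmorphXn.
  have /choice[a aP] : forall k : 'I_d.+1, exists a,
      iota a = \sum_t mu t * (phi (p t) ^+ (d - k) * phi (q t) ^+ k).
    move=> k; have kd : (k <= d)%N by rewrite -ltnS.
    by have [a aE] := rat k kd; exists a; rewrite muE.
  exists (\sum_(k < d.+1) w k * (a k)%:C%C).
  rewrite rmorph_sum /=.
  under eq_bigr do rewrite rmorphM /= complexify_real aP.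
  rewrite (pairing_sum d (fun k => phi (w k))) (bigD1 t) //= phi_w eqxx mulr1.
  by rewrite big1 ?addr0 // => u ut; rewrite phi_w (negbTE ut) mulr0.
have sumE k : phi (\sum_t l t * (p t ^+ (d - k) * q t ^+ k)) =
    \sum_t mu t * (phi (p t) ^+ (d - k) * phi (q t) ^+ k).
  by rewrite rmorph_sum; apply: eq_bigr => t _; rewrite /= !rmorphM !rmorphXn /= lE.
have lK0 t : l t != 0.
  by rewrite -(fmorph_eq0 phi) /= lE mulf_neq0 ?invr_eq0 ?expf_neq0.
have [|s [ss sp sq sl]] := conjc_permutes d5 indepK lK0 norm.
  move=> k kd; have [a aE] := rat k kd.
  have -> : \sum_t l t * (p t ^+ (d - k) * q t ^+ k) = a%:C%C.
    by apply: (fmorph_inj phi); rewrite /= sumE muE // -aE complexify_real.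
  exact: conjc_real.
(* If [s] were the identity, weights and points would be fixed by conjugation and give a
   representation of length 3 over K. *)
have [j sj] : exists j, s j != j.
  apply/existsP; rewrite -negb_forall; apply/negP => /forallP fix_s.
  apply: norep; exists (phi \o l), (phi \o p), (phi \o q); split.
    by move=> t; split; apply/image_complexify_real; rewrite ?sl ?sp ?sq (eqP (fix_s t)).
  apply: sum_summand_ext => k kd; rewrite -muE // -sumE rmorph_sum.
  by apply: eq_bigr => t _; rewrite /= !rmorphM !rmorphXn.
have [i [u si]] := involution_ord3 ss sj.
exists e, l, p, q, s, i, j; split=> //; split=> // t.
by rewrite lE divfK // expf_neq0.
Qed.

End Descent.

(** * The cubic with the three points as zeros, and its Vandermonde product *)

Section Conclusion.
Variables (K : rcfType) (C : numClosedFieldType) (iota : {rmorphism K -> C}).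
Variables (p q : 'I_3 -> K[i]) (s : 'I_3 -> 'I_3).
Local Notation phi := (complexify iota).
Local Notation conj := (@conjc K : K[i] -> K[i]).
Hypotheses (ss : involutive s) (indep : independent p q).
Hypotheses (sp : forall t, conj (p t) = p (s t)) (sq : forall t, conj (q t) = q (s t)).

Let cubic : {mpoly C[2]} := \prod_(t < 3) (phi (q t) *: 'X_0 - phi (p t) *: 'X_1).

(** Conjugation only permutes the linear factors, by [s]. *)
Lemma conj_invariant_cubic m : cubic@_m \in image_field iota.
Proof.
pose H : {mpoly K[i][2]} := \prod_(t < 3) (q t *: 'X_0 - p t *: 'X_1).
have -> : cubic = map_mpoly phi H.
  rewrite rmorph_prod; apply: eq_bigr => t _.
  by rewrite rmorphB /= !map_mpolyZ !map_mpolyX.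
rewrite mcoeff_map_mpoly; apply/image_complexify_real.
have {2}<- : map_mpoly (@conjc K) H = H; last by rewrite mcoeff_map_mpoly.
rewrite rmorph_prod [RHS](reindex_inj (inv_inj ss)) /=; apply: eq_bigr => t _.
by rewrite rmorphB /= !map_mpolyZ !map_mpolyX /= sp sq.
Qed.

Lemma cubic_neq0 : cubic != 0.
Proof.
apply/prodf_neq0 => t _.
have [u tu] := ord3_other t.
have := independent_neq0 indep tu; apply: contraNneq => E.
have := congr1 (mcoeff U_(0)) E; have := congr1 (mcoeff U_(1)) E.
rewrite !mcoeffB !mcoeffZ !mcoeffXU !mcoeff0 /= !mulr0 !mulr1 sub0r subr0.
move=> /eqP; rewrite oppr_eq0 fmorph_eq0 => /eqP ->.
by move=> /eqP; rewrite fmorph_eq0 => /eqP ->.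
Qed.

(** Rescaling multiplies [cubic], a nonzero form over K, by the product of the scalars. A nonzero
    coefficient exhibits this product as a quotient of elements of K. *)
Lemma normalized_scale (c a b : 'I_3 -> C) :
  (forall t, a t = c t * phi (p t)) -> (forall t, b t = c t * phi (q t)) ->
  normalized (image_field iota) a b <->
  exists x : K, \prod_t c t = iota x.
Proof.
move=> aE bE; rewrite /normalized.
have -> : \prod_(t < 3) (b t *: 'X_0 - a t *: 'X_1) = (\prod_t c t) *: cubic.
  rewrite -scaler_prod; apply: eq_bigr => t _.
  by rewrite aE bE scalerBr !scalerA.
have S0 : 0 \in image_field iota by rewrite -(rmorph0 iota) mem_image_field.
have [m m0] : exists m, cubic@_m != 0.
  apply: contrapT => /forallNP nm; case/eqP: cubic_neq0; apply/mpolyP => m.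
  by rewrite mcoeff0; apply/eqP; apply: contraT => /nm.
split=> [/(mpolyOver_coefP _ S0)/(_ m)|[x ->]].
  have /image_fieldP[y yE] := conj_invariant_cubic m.
  rewrite mcoeffZ yE => /image_fieldP[x xE]; exists (x / y).
  by rewrite fmorph_div -xE mulfK // -yE.
apply/(mpolyOver_coefP _ S0) => n; rewrite mcoeffZ.
have /image_fieldP[z ->] := conj_invariant_cubic n.
by rewrite -rmorphM mem_image_field.
Qed.

Lemma conj_vandermonde3 (i j : 'I_3) :
  uniq [:: i; j; s j] -> s i = i ->
  conj (vandermonde3 p q) = - vandermonde3 p q.
Proof.
move=> u si; rewrite -(vandermonde3_swap p q u si (ss j)) /vandermonde3 /=.
by rewrite !rmorphM !rmorphB !rmorphM /= !sp !sq.
Qed.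

Lemma vandermonde3_neq0 : vandermonde3 p q != 0.
Proof.
have V i j : i != j -> q i * p j - q j * p i != 0.
  by move=> ij; rewrite subr_eq0 mulrC; apply: indep; rewrite eq_sym.
by rewrite /vandermonde3 !mulf_neq0 // V.
Qed.

End Conclusion.

(** * Identification of K(sqrt u) with K(i), and the conclusion *)

Theorem corollary4p4 (R : realType) (K : rcfType) (iota : {rmorphism K -> R[i]})
    (d : nat) (lambda alpha beta : 'I_3 -> R[i]) (f : {mpoly R[i][2]}) :
  (5 <= d)%N ->
  f = \sum_(j < 3) summand d (lambda j) (alpha j) (beta j) ->
  f \is a mpolyOver 2 (image_field iota) ->
  honest lambda alpha beta ->
  (3 < rank (image_field iota) d f)%N ->
  let rescaling (c : 'I_3 -> R[i]) :=
    (forall j, c j != 0) /\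
    normalized (image_field iota)
      (fun j => c j * alpha j) (fun j => c j * beta j) in
  (exists c, rescaling c) /\
  forall c, rescaling c ->
    let u := disc3 (fun j => c j * alpha j) (fun j => c j * beta j) in
    let L := adjoin (image_field iota) (sqrtC u) in
    let g j := summand d (lambda j) (alpha j) (beta j) in
    rank L d f = 3%N /\
    exists i j k : 'I_3,
      [/\ uniq [:: i; j; k],
          g i \is a mpolyOver 2 (image_field iota)
        & conjugates (image_field iota) L (g j) (g k)].
Proof.
move=> d5 fE; rewrite {f}fE => fK hon rk3 rescaling.
have norep : ~ has_repr (image_field iota) d
    (\sum_i summand d (lambda i) (alpha i) (beta i)) 3.
  by move/rank_leq; rewrite leqNgt rk3.
have [e [l [p [q [s [i [j [[e0 indep pE qE lE] [ss sp sq sl] [u si]]]]]]]]] :=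
  descent d5 hon fK norep.
have aE t : alpha t = (e t)^-1 * complexify iota (p t) by rewrite -pE mulKf.
have bE t : beta t = (e t)^-1 * complexify iota (q t) by rewrite -qE mulKf.
have normE c : normalized (image_field iota)
      (fun t => c t * alpha t) (fun t => c t * beta t) <->
    exists x : K, \prod_t (c t / e t) = iota x.
  by apply: (normalized_scale (c := fun t => c t / e t) ss indep sp sq) => t;
    rewrite ?aE ?bE mulrA.
split.
  (* Scaling by [e] gives the normal representatives, for which the product of ratios is 1. *)
  exists e; split=> //; apply/normE; exists 1.
  by rewrite rmorph1 big1 // => t _; rewrite divff.
move=> c [c0 /normE[x xE]] /=.
set g := fun t => summand d (lambda t) (alpha t) (beta t).
(* The Vandermonde product of the points scaled by [c]: passing from [p], [q] to them costs the
   square of the product [x] of the ratios [c t / e t]. *)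
pose w := x%:C%C ^+ 2 * vandermonde3 p q.
have cw : conjc w = - w.
  rewrite /w rmorphM rmorphXn [X in X ^+ _ * _](conjc_real x).
  rewrite [X in _ * X](conj_vandermonde3 ss sp sq u si).
  by rewrite mulrN.
have w0 : w != 0.
  rewrite mulf_neq0 ?vandermonde3_neq0 // expf_neq0 //.
  have : \prod_t (c t / e t) != 0.
    by apply/prodf_neq0 => t _; rewrite mulf_neq0 ?invr_eq0.
  by rewrite xE fmorph_eq0; apply: contraNneq => /(@complexI K) ->.
have uE : disc3 (fun t => c t * alpha t) (fun t => c t * beta t) = complexify iota w ^+ 2.
  rewrite disc3_vandermonde; congr (_ ^+ 2).
  have -> : (fun t => c t * alpha t) = (fun t => c t / e t * complexify iota (p t)).
    by apply/funext => t; rewrite aE mulrA.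
  have -> : (fun t => c t * beta t) = (fun t => c t / e t * complexify iota (q t)).
    by apply/funext => t; rewrite bE mulrA.
  rewrite vandermonde3Z xE -complexify_real /w /vandermonde3.
  by rewrite !(rmorphM, rmorphB, rmorphXn).
(* [sqrtC] may select either [w] or [- w]; conjugation negates both. *)
have [w' [cw' w'0 ->]] : exists w', [/\ conjc w' = - w', w' != 0 &
    sqrtC (disc3 (fun t => c t * alpha t) (fun t => c t * beta t)) = complexify iota w'].
  have /eqP := sqrtCK (disc3 (fun t => c t * alpha t) (fun t => c t * beta t)).
  rewrite [X in _ == X]uE eqf_sqr => /orP[]/eqP->; first by exists w.
  by exists (- w); rewrite !rmorphN /= cw oppr_eq0.
rewrite (adjoin_complexify iota cw' w'0).
have gE t : g t = summand d (complexify iota (l t))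
    (complexify iota (p t)) (complexify iota (q t)).
  rewrite /g /summand lE -pE -qE /linform -!scalerA -scalerDr exprZn.
  by rewrite scalerA.
split.
  apply: rank_eq => [|n]; last exact: honest_minimal (ltnW d5) hon.
  exists (complexify iota \o l), (complexify iota \o p), (complexify iota \o q).
  split; first by move=> t; split; exact: mem_image_field.
  by apply: eq_bigr => t _; rewrite -/(g t) gE.
(* The coefficients of the summands, taken in K(i), where conjugation sends those of [t] to those of
   [s t]. *)
pose coef t (m : 'X_{1..2}) :=
  (l t * (p t ^+ (d - m 1) * q t ^+ m 1)) *+ ((mdeg m == d) * 'C(d, m 1)).
have gcoef t m : (g t)@_m = complexify iota (coef t m).
  by rewrite gE mcoeff_summand rmorphMn /= !rmorphM !rmorphXn.
have conj_coef t m : conjc (coef t m) = coef (s t) m.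
  by rewrite rmorphMn /= !rmorphM !rmorphXn /= sl sp sq.
have gL t : g t \is a mpolyOver 2 (image_field (complexify iota)).
  apply/mpolyOver_coefP => [|m]; last by rewrite gcoef mem_image_field.
  by rewrite -(rmorph0 (complexify iota)) mem_image_field.
exists i, j, (s j); split=> //.
  apply/mpolyOver_coefP => [|m]; first by rewrite -(rmorph0 iota) mem_image_field.
  by rewrite gcoef; apply/image_complexify_real; rewrite conj_coef si.
split; [exact: gL | exact: gL |].
have [sigma sigma_aut sigmaE] := conj_automorphism iota.
exists sigma; first exact: sigma_aut.
move=> m; apply: etrans (gcoef (s j) m) _.
apply: etrans (congr1 sigma (esym (gcoef j m))).
by rewrite sigmaE conj_coef.
Qed.
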